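(* Let $\mathcal{A}$ be a nice GFG-tNCW. If $\mathcal{A}$ is safe-centralized and safe-minimal, then $\mathcal{A}$ is a minimal GFG-tNCW for $L(\mathcal{A})$; that is, every GFG-tNCW $\mathcal{B}$ with $L(\mathcal{B})=L(\mathcal{A})$ has at least as many states as $\mathcal{A}$.
   Context: A tNCW (transition-based nondeterministic co-Büchi word automaton) is $\mathcal{A}=\langle \Sigma,Q,q_0,\delta,\alpha\rangle$ with finite alphabet $\Sigma$, finite state set $Q$, initial state $q_0$, total transition function $\delta:Q\times\Sigma\to 2^Q\setminus\{\emptyset\}$ inducing the transition relation $\Delta=\{\langle q,\sigma,s\rangle : s\in\delta(q,\sigma)\}$, and $\alpha\subseteq\Delta$. Transitions in $\alpha$ are $\alpha$-transitions, the others are $\bar\alpha$-transitions; $\delta^{\bar\alpha}(q,\sigma)$ denotes the set of $s$ with $\langle q,\sigma,s\rangle\in\Delta\setminus\alpha$. A run on $w=\sigma_1\sigma_2\cdots$ is $r_0r_1\cdots$ with $r_0=q_0$ and $r_{i+1}\in\delta(r_i,\sigma_{i+1})$; it is accepting iff it traverses $\alpha$-transitions only finitely often. $L(\mathcal{A})$ is the set of words with an accepting run; the size of $\mathcal{A}$ is $|Q|$. For $q\in Q$, $\mathcal{A}^q$ is $\mathcal{A}$ with initial state $q$. $\mathcal{A}$ is GFG if there is $f:\Sigma^*\to Q$ with $f(\epsilon)=q_0$, $\langle f(u),\sigma,f(u\sigma)\rangle\in\Delta$ for all $u\in\Sigma^*,\sigma\in\Sigma$, and such that for every $w\in L(\mathcal{A})$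 the run $f(w[1,0]),f(w[1,1]),f(w[1,2]),\dots$ is accepting; a state $q$ is GFG if $\mathcal{A}^q$ is GFG. A run is safe if it uses no $\alpha$-transition; $L_{safe}(\mathcal{A}^q)$ is the set of infinite words having a safe run from $q$. For states $q,s$: $q\sim s$ iff $L(\mathcal{A}^q)=L(\mathcal{A}^s)$; $q\approx s$ iff $q\sim s$ and $L_{safe}(\mathcal{A}^q)=L_{safe}(\mathcal{A}^s)$; $q\precsim s$ iff $q\sim s$ and $L_{safe}(\mathcal{A}^q)\subseteq L_{safe}(\mathcal{A}^s)$. The safe components of $\mathcal{A}$ are the strongly connected components of the directed graph on $Q$ having an edge $q\to q'$ iff some $\bar\alpha$-transition $\langle q,\sigma,q'\rangle$ exists. $\mathcal{A}$ is semantically deterministic if for all $q,\sigma$, any two $\sigma$-successors of $q$ are $\sim$-equivalent; safe deterministic if $|\delta^{\bar\alpha}(q,\sigma)|\le 1$ for all $q,\sigma$; normal if whenever there is a path of $\bar\alpha$-transitions from $q$ to $s$ there is also one from $s$ to $q$. A GFG-tNCW is nice if all its states are reachable from $q_0$ and GFG, and it is normal, safe deterministic and semantically deterministic. $\mathcal{A}$ is safe-minimal if no two distinct states $q,s$ satisfy $q\approx s$, and safe-centralized if $q\precsim s$ implies that $q$ and $s$ lie in the same safe component. *)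

(* Defs.v *)
From mathcomp Require Import all_boot.

Set Implicit Arguments.
Unset Strict Implicit.
Unset Printing Implicit Defensive.

Record tNCW (Sigma : finType) := TNCW {
  state : finType;
  init : state;
  delta : state -> Sigma -> {set state};
  delta_total : forall q a, delta q a != set0;
  alpha : {set state * Sigma * state};
  alpha_sub : forall q a s, (q, a, s) \in alpha -> s \in delta q a
}.

Arguments init {Sigma} t.
Arguments delta {Sigma} t.
Arguments alpha {Sigma} t.

Section TNCW.
Variable Sigma : finType.
Implicit Types (A B : tNCW Sigma).

(* Letters are indexed from 0, so the first n letters of w are w 0, ..., w n.-1. *)
Definition word := nat -> Sigma.
Implicit Types (w : word).

Definition word_prefix w n : seq Sigma := mkseq w n.

Definition with_init A (q : state A) : tNCW Sigma :=
  TNCW q (@delta_total _ A) (@alpha_sub _ A).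

Definition safe_delta A (q : state A) (a : Sigma) : {set state A} :=
  [set s in delta A q a | (q, a, s) \notin alpha A].

Definition run A w (r : nat -> state A) : Prop :=
  r 0 = init A /\ forall i, r i.+1 \in delta A (r i) (w i).

Definition accepting A w (r : nat -> state A) : Prop :=
  exists n, forall i, n <= i -> (r i, w i, r i.+1) \notin alpha A.

Definition safe A w (r : nat -> state A) : Prop :=
  forall i, (r i, w i, r i.+1) \notin alpha A.

Definition lang A w : Prop := exists r, run w r /\ @accepting A w r.

Definition safe_lang A w : Prop := exists r, run w r /\ @safe A w r.

Definition GFG A : Prop :=
  exists f : seq Sigma -> state A,
    [/\ f [::] = init A,
        forall u a, f (rcons u a) \in delta A (f u) a &
        forall w, lang A w -> accepting w (fun i => f (word_prefix w i))].

Definition GFG_state A (q : state A) : Prop := GFG (with_init q).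

Definition lang_equiv A (q s : state A) : Prop :=
  forall w, lang (with_init q) w <-> lang (with_init s) w.

Definition strong_equiv A (q s : state A) : Prop :=
  lang_equiv q s /\
  forall w, safe_lang (with_init q) w <-> safe_lang (with_init s) w.

Definition subsafe_equiv A (q s : state A) : Prop :=
  lang_equiv q s /\
  forall w, safe_lang (with_init q) w -> safe_lang (with_init s) w.

Definition edge A : rel (state A) :=
  fun q s => [exists a, s \in delta A q a].

Definition safe_edge A : rel (state A) :=
  fun q s => [exists a, s \in safe_delta q a].

Definition safe_component A (q : state A) : {set state A} :=
  [set s | connect (@safe_edge A) q s && connect (@safe_edge A) s q].

Definition semantically_deterministic A : Prop :=
  forall (q : state A) a s s',
    s \in delta A q a -> s' \in delta A q a -> lang_equiv s s'.

Definition safe_deterministic A : Prop :=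
  forall (q : state A) a, #|safe_delta q a| <= 1.

Definition normal A : Prop :=
  forall q s : state A,
    connect (@safe_edge A) q s -> connect (@safe_edge A) s q.

Definition nice A : Prop :=
  [/\ forall q : state A, connect (@edge A) (init A) q,
      forall q : state A, GFG_state q,
      normal A,
      safe_deterministic A &
      semantically_deterministic A].

Definition safe_minimal A : Prop :=
  forall q s : state A, strong_equiv q s -> q = s.

Definition safe_centralized A : Prop :=
  forall q s : state A, subsafe_equiv q s -> s \in safe_component q.

End TNCW.

(* Main.v *)
(** An injection from the states of A to those of B is obtained by giving each
    state of A a state of B with the same language and the same safe words.
    Since B need not be nice, its safe transitions are first replaced by its
    "core": the safe transitions that compute exact residual languages and that
    can be undone by such transitions; in a nice automaton these are all the
    safe transitions, and the run of a GFG strategy on an accepted word is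
    eventually in the core.  If q is a state of A, a strategy of B must at some
    point stay in the core on all safe words of q, or else infinitely many
    failures can be chained into an accepted word that it rejects.  The
    symmetric argument bounds the core words of the state of B so reached by
    the safe words of a state of A.  When q is maximal for inclusion of safe
    words among the states equivalent to it, both inclusions are equalities,
    and following the strategy along safe words from q transfers the
    correspondence to the whole safe component of q.  Safe-centrality puts a
    maximal state in every safe component, and safe-minimality makes the
    correspondence injective. *)

Require Import Defs.
From mathcomp Require Import all_boot.
From mathcomp Require Import boolp.

Set Implicit Arguments.
Unset Strict Implicit.
Unset Printing Implicit Defensive.

(** * Infinite words and their finite prefixes *)

Section Words.
Variable Sigma : Type.
Implicit Types (w : nat -> Sigma) (u v : seq Sigma).

Definition scons (a : Sigma) w : nat -> Sigma :=
  fun i => if i is j.+1 then w j else a.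

Definition catw u w : nat -> Sigma := foldr scons w u.

Definition dropw n w : nat -> Sigma := fun i => w (n + i).

Lemma catw_cat u v w : catw (u ++ v) w = catw u (catw v w).
Proof. exact: foldr_cat. Qed.

Lemma scons_dropw w : scons (w 0) (dropw 1 w) = w.
Proof. by apply: funext => -[|i]. Qed.

Lemma mkseqD w m n : mkseq w (m + n) = mkseq w m ++ mkseq (dropw m w) n.
Proof.
rewrite /mkseq iotaD map_cat add0n -[in iota m n](addn0 m) iotaDl -map_comp.
by congr (_ ++ _); apply: eq_map.
Qed.

Lemma catw_dropw n w : catw (mkseq w n) (dropw n w) = w.
Proof.
elim: n w => [|n IHn] w; first exact: funext.
rewrite -add1n mkseqD -[RHS]scons_dropw /=; congr scons.
by rewrite -[RHS](IHn (dropw 1 w)).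
Qed.

Lemma catw_addn u w i : catw u w (size u + i) = w i.
Proof. by elim: u. Qed.

Lemma mkseq_catw u w n : mkseq (catw u w) (size u + n) = u ++ mkseq w n.
Proof.
elim: u => //= a u IHu.
by rewrite addSn /mkseq /= -[1]addn0 iotaDl -map_comp -IHu.
Qed.

Lemma mkseq_catw_size u w : mkseq (catw u w) (size u) = u.
Proof. by rewrite -[size u]addn0 mkseq_catw cats0. Qed.

(** Nonempty increments make the lengths grow, so letter [i] of the limit can be read off
    [v i.+1]. *)
Lemma limit_word (v x : nat -> seq Sigma) :
  (forall k, x k <> [::]) -> (forall k, v k.+1 = v k ++ x k) ->
  (forall k, k <= size (v k)) /\
  exists w, forall k, mkseq w (size (v k)) = v k.
Proof.
move=> xn0 vS.
have szv k : k <= size (v k).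
  elim: k => // k IHk; rewrite vS size_cat -addn1 leq_add //.
  by case: (x k) (xn0 k).
split=> //.
have [a _] : exists a : Sigma, True by case: (x 0) (xn0 0) => // a; exists a.
have vD k m : exists y, v (k + m) = v k ++ y.
  elim: m => [|m [y Ey]]; first by exists [::]; rewrite addn0 cats0.
  by exists (y ++ x (k + m)); rewrite addnS vS Ey catA.
have vnth k m i : i < size (v k) -> nth a (v (k + m)) i = nth a (v k) i.
  by move=> ltik; have [y ->] := vD k m; rewrite nth_cat ltik.
exists (fun i => nth a (v i.+1) i) => k.
apply: (@eq_from_nth _ a); rewrite size_mkseq // => i ltik.
rewrite nth_mkseq //.
have [le|/ltnW le] := leqP k i.+1.
  by rewrite -(subnKC le) vnth.
by rewrite -(subnKC le) vnth.
Qed.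

End Words.

(** * Finite paths, compactness and recurrence *)

Section Steps.
Variables (Sigma : Type) (T : Type) (D : T -> Sigma -> T -> Prop).

Fixpoint steps (q : T) (u : seq Sigma) (s : T) : Prop :=
  if u is a :: u' then exists2 q', D q a q' & steps q' u' s else q = s.

Definition traceable q u := exists s, steps q u s.

Lemma steps_cat q u v s :
  steps q (u ++ v) s <-> exists2 q', steps q u q' & steps q' v s.
Proof.
elim: u q => [|a u IHu] q /=.
  by split=> [|[q' <-]] //; exists q.
split=> [[q1 Dq /IHu[q' uq' vs]]|[q' [q1 Dq uq'] vs]].
  by exists q' => //; exists q1.
by exists q1 => //; apply/IHu; exists q'.
Qed.

Lemma traceable_catl q u v : traceable q (u ++ v) -> traceable q u.
Proof. by case=> s /steps_cat[q' uq' _]; exists q'. Qed.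

Lemma steps_run (w : nat -> Sigma) (r : nat -> T) n :
  (forall i, D (r i) (w i) (r i.+1)) -> steps (r 0) (mkseq w n) (r n).
Proof.
move=> Dr; elim: n => // n IHn.
rewrite /mkseq -addn1 iotaD map_cat; apply/steps_cat; exists (r n) => //=.
by exists (r (n + 1)) => //; rewrite addn1 add0n.
Qed.

End Steps.

(** A state reading all prefixes of a word has a successor reading all prefixes of its tail:
    otherwise every state of [T] fails at some length, and a prefix longer than all of these gives a
    contradiction. *)
Lemma koenig Sigma (T : finType) (D : T -> Sigma -> T -> Prop) q w :
  (forall n, traceable D q (mkseq w n)) ->
  exists r : nat -> T, r 0 = q /\ forall i, D (r i) (w i) (r i.+1).
Proof.
move=> trq.
pose K i p := forall n, traceable D p (mkseq (dropw i w) n).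
have stepK i p : exists p', K i p -> D p (w i) p' /\ K i.+1 p'.
  apply: contrapT => noK.
  have {}noK p' : exists n, K i p /\
      (D p (w i) p' -> ~ traceable D p' (mkseq (dropw i.+1 w) n)).
    apply: contrapT => nop'; apply: noK; exists p' => Kp; split.
      by apply: contrapT => nD; apply: nop'; exists 0.
    by move=> n; apply: contrapT => ntr; apply: nop'; exists n.
  have [N NP] := choice noK.
  have dropwS : dropw 1 (dropw i w) = dropw i.+1 w.
    by apply: funext => j; rewrite /dropw addnA addn1.
  have [Kp _] := NP p; have := Kp (\max_p' N p').+1.
  rewrite -add1n mkseqD dropwS => -[s /= [p']]; rewrite /dropw addn0 => Dp st.
  have [_ /(_ Dp)] := NP p'; apply.
  have: traceable D p' (mkseq (dropw i.+1 w) (\max_p' N p')) by exists s.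
  by rewrite -(subnKC (leq_bigmax p' : N p' <= _)) mkseqD;
    apply: traceable_catl.
have [h hP] := choice (fun ip : nat * T => stepK ip.1 ip.2).
pose r := fix r i := if i is j.+1 then h (j, r j) else q.
have Kr i : K i (r i).
  elim: i => [|i IHi]; last by have [] := hP (i, r i) IHi.
  exact: trq.
by exists r; split=> // i; have [] := hP (i, r i) (Kr i).
Qed.

(** Each value either disappears past some point or recurs forever; the finitely many thresholds
    have a maximum. *)
Lemma eventually_recurrent (T : finType) (r : nat -> T) :
  exists N, forall i, N <= i -> exists2 j, i < j & r j = r i.
Proof.
have cofinal x : exists N,
    (forall j, N <= j -> r j <> x) \/ (forall M, exists2 j, M <= j & r j = x).
  have [inf|/existsNP[N noN]] :=
      pselect (forall M, exists2 j, M <= j & r j = x).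
    by exists 0; right.
  by exists N; left=> j leNj rj; apply: noN; exists j.
have [N NP] := choice cofinal.
exists (\max_x N x) => i leNi.
have [never|/(_ i.+1)//] := NP (r i).
by case: (never i) => //; apply: leq_trans (leq_bigmax _) leNi.
Qed.

(** * The core of an automaton and the strategies *)

Section Automata.
Variable Sigma : finType.
Implicit Types (A B : tNCW Sigma) (u v : seq Sigma) (w : word Sigma).

Definition trans A (q : state A) a s : Prop := s \in delta A q a.

Lemma lang_scons A (q s : state A) a w : s \in delta A q a ->
  lang (with_init s) w -> lang (with_init q) (scons a w).
Proof.
move=> qas [r [[r0 rS] [n rn]]].
exists (fun i => if i is j.+1 then r j else q); split; last first.
  by exists n.+1 => -[|i] //; apply: rn.
by split=> // -[|i] /=; [rewrite r0 | apply: rS].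
Qed.

Lemma lang_dropw A w r n : run w r -> accepting w r ->
  lang (with_init (r n : state A)) (dropw n w).
Proof.
move=> [_ rS] [m rm]; exists (fun i => r (n + i)); split.
  by split=> [|i] /=; rewrite ?addn0 // addnS; apply: rS.
by exists m => i lemi; rewrite addnS; apply: rm; rewrite (leq_trans lemi) // leq_addl.
Qed.

Lemma lang_catw A (q s : state A) u w : steps (@trans A) q u s ->
  lang (with_init s) w -> lang (with_init q) (catw u w).
Proof.
elim: u q => [|a u IHu] q /=; first by move=> ->.
by case=> q' qaq' /IHu us /us; apply: lang_scons.
Qed.

Definition exact_trans A (q : state A) a s : Prop :=
  s \in safe_delta q a /\
  forall w, lang (with_init s) w <-> lang (with_init q) (scons a w).

Definition core A (q : state A) a s : Prop :=
  exact_trans q a s /\ exists u, steps (@exact_trans A) s u q.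

Lemma core_safe A (q : state A) a s : core q a s -> s \in safe_delta q a.
Proof. by case=> -[]. Qed.

Lemma steps_core_lang A (q s : state A) u w : steps (@core A) q u s ->
  lang (with_init s) w <-> lang (with_init q) (catw u w).
Proof.
elim: u q => [|a u IHu] q /=; first by move=> ->.
by case=> q' [[_ ex] _] /IHu ->; apply: ex.
Qed.

(** The rest of the cycle is a return path for each of its transitions; the induction moves each
    letter read to the end of [v]. *)
Lemma cycle_core A (q s : state A) u v : steps (@exact_trans A) q u s ->
  steps (@exact_trans A) s v q -> steps (@core A) q u s.
Proof.
elim: u q v => //= a u IHu q v [q' qaq' us] vq; exists q'.
  by split=> //; exists (u ++ v); apply/steps_cat; exists s.
apply: (IHu _ (v ++ [:: a])) => //; apply/steps_cat; exists q => //=.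
by exists q'.
Qed.

(** The return path of a core transition closes a cycle with it, hence is itself in the core. *)
Lemma core_return A (q s : state A) u : steps (@core A) q u s ->
  exists v, steps (@core A) s v q.
Proof.
elim: u q => [|a u IHu] q /=; first by move=> ->; exists [::].
case=> q' [ex [v vq]] /IHu[v' v'q']; exists (v' ++ v).
apply/steps_cat; exists q' => //; apply: (cycle_core (v := [:: a])) => //=.
by exists q'.
Qed.

(* [q] accepts the residual of the language of [A] by [u]; [u] need not lead to
   [q]. *)
Definition residual A (q : state A) u : Prop :=
  forall w, lang (with_init q) w <-> lang A (catw u w).

Definition strategy A (f : seq Sigma -> state A) : Prop :=
  [/\ f [::] = init A,
      forall u a, f (rcons u a) \in delta A (f u) a &
      forall w, lang A w -> accepting w (fun i => f (word_prefix w i))].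

Lemma strategy_run A f w : @strategy A f ->
  run w (fun i => f (word_prefix w i)).
Proof.
by case=> f0 fS _; split=> // i; rewrite /word_prefix mkseqS.
Qed.

(** If [catw u w] is accepted, then [f] accepts it along a run through [f u], whose tail accepts
    [w]. *)
Lemma strategy_residual A f u : @strategy A f -> residual (f u) u.
Proof.
move=> fP w; have [f0 fS fa] := fP; split=> [|/fa acc].
  suff st: steps (@trans A) (init A) u (f u).
    exact: (@lang_catw A _ _ u w st).
  rewrite -f0; elim/last_ind: u => // u a IHu.
  rewrite -cats1; apply/steps_cat; exists (f u) => //=.
  by exists (f (u ++ [:: a])) => //; rewrite cats1; apply: fS.
have := lang_dropw (size u) (strategy_run (catw u w) fP) acc.
rewrite /word_prefix mkseq_catw_size; congr lang; apply: funext => i.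
exact: catw_addn.
Qed.

(** Transitions of [f] are exact because its states accept residuals. Past some point all are safe
    and all states recur, so the run up to the next visit is the return path. *)
Lemma strategy_eventually_core A f w : @strategy A f -> lang A w ->
  exists N, forall i, N <= i ->
    core (f (word_prefix w i)) (w i) (f (word_prefix w i.+1)).
Proof.
move=> fP Lw; have [f0 fS fa] := fP; have [n nP] := fa w Lw.
pose r i := f (word_prefix w i).
have ex i : n <= i -> exact_trans (r i) (w i) (r i.+1).
  move=> leni; split.
    by have [_ rS] := strategy_run w fP; rewrite inE rS nP.
  move=> w'; rewrite (strategy_residual _ fP w') (strategy_residual _ fP _).
  by rewrite /word_prefix mkseqS -cats1 catw_cat.
have [N NP] := eventually_recurrent r.
exists (maxn n N) => i; rewrite geq_max => /andP[leni leNi]; split.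
  exact: ex.
have [j ltij rji] := NP i leNi.
exists (mkseq (dropw i.+1 w) (j - i.+1)).
rewrite -/(r i.+1) -/(r i) -rji -{2}(subnKC ltij) -{1}[i.+1]addn0.
apply: (@steps_run _ _ _ _ (fun k => r (i.+1 + k))) => k.
by rewrite addnS; apply: ex; rewrite (leq_trans leni) // ltnW // leq_addr.
Qed.

Fixpoint follows A (f : seq Sigma -> state A) u v : Prop :=
  if v is a :: v' then
    core (f u) a (f (rcons u a)) /\ follows f (rcons u a) v'
  else True.

Lemma follows_cat A (f : seq Sigma -> state A) u v v' :
  follows f u (v ++ v') <-> follows f u v /\ follows f (u ++ v) v'.
Proof.
elim: v u => [|a v IHv] u /=; first by rewrite cats0; tauto.
by rewrite IHv cat_rcons; tauto.
Qed.

Lemma follows_steps A (f : seq Sigma -> state A) u v :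
  follows f u v -> steps (@core A) (f u) v (f (u ++ v)).
Proof.
elim: v u => [|a v IHv] u /=; first by rewrite cats0.
by case=> fua /IHv; rewrite cat_rcons; exists (f (rcons u a)).
Qed.

Lemma follows_word A (f : seq Sigma -> state A) u v w :
  let w' := catw u (catw v w) in
  (forall i, size u <= i ->
     core (f (word_prefix w' i)) (w' i) (f (word_prefix w' i.+1))) ->
  follows f u v.
Proof.
elim: v u => //= a v IHv u corew; split.
  have := corew (size u) (leqnn _).
  rewrite /word_prefix mkseqS mkseq_catw_size.
  suff -> : catw u (scons a (catw v w)) (size u) = a by [].
  by rewrite -[size u]addn0 catw_addn.
apply: IHv => i; rewrite size_rcons -cats1 catw_cat => /ltnW.
exact: corew.
Qed.

(* Otherwise the core loops at [q] on which [f] leaves the core of [B] can be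
   concatenated forever, to a word of the language on which [f] fails. *)
Lemma strategy_follows_core A B (f : seq Sigma -> state B) (q : state A) u0 :
  strategy f -> (forall w, lang A w <-> lang B w) -> residual q u0 ->
  exists2 v, steps (@core A) q v q &
    forall v', traceable (@core A) q v' -> follows f (u0 ++ v) v'.
Proof.
move=> fP eqL resq; apply: contrapT => nofollow.
have step v : exists x, steps (@core A) q v q ->
    steps (@core A) q x q /\ ~ follows f (u0 ++ v) x.
  have [loopv|nloop] := pselect (steps (@core A) q v q); last by exists [::].
  have [v' [[s qv's] nfol]] : exists v',
      traceable (@core A) q v' /\ ~ follows f (u0 ++ v) v'.
    apply: contrapT => nov'; apply: nofollow; exists v => // v' trv'.
    by apply: contrapT => nfol; apply: nov'; exists v'.
  (* Closing the failing word into a loop at [q] lets the construction continue. *)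
  have [v'' sv''q] := core_return qv's.
  exists (v' ++ v'') => _; split; first by apply/steps_cat; exists s.
  by move/follows_cat => -[].
have [h hP] := choice step.
pose v := fix v k := if k is j.+1 then v j ++ h (v j) else [::].
have loopv k : steps (@core A) q (v k) q.
  by elim: k => //= k IHk; apply/steps_cat; exists q => //; have [] := hP _ IHk.
have [k|k|szv [w wP]] := @limit_word _ v (h \o v).
(* Each added loop is nonempty, as the empty word is trivially followed. *)
- by move=> /= hv; have [_] := hP _ (loopv k); rewrite hv; apply.
- by [].
have trq n : traceable (@core A) q (mkseq w n).
  have : traceable (@core A) q (v n) by exists q.
  by rewrite -(wP n) -(subnKC (szv n)) mkseqD; apply: traceable_catl.
have [r [r0 rP]] := koenig trq.
have Lw : lang (with_init q) w.
  exists r; split; last first.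
    by exists 0 => i _; have /core_safe := rP i; rewrite inE => /andP[].
  by split=> // i; have /core_safe := rP i; rewrite inE => /andP[].
(* The loop added at stage [N] starts at or after position [N], where [f] already stays in the
   core. *)
have [N NP] := strategy_eventually_core fP ((eqL _).1 ((resq w).1 Lw)).
have [_] := hP _ (loopv N); apply.
apply: (@follows_word _ _ _ _ (dropw (size (v N.+1)) w)).
have -> : catw (u0 ++ v N) (catw (h (v N)) (dropw (size (v N.+1)) w)) =
    catw u0 w.
  rewrite catw_cat -[catw (v N) _]catw_cat -[v N ++ _]/(v N.+1).
  by rewrite -[in catw (v N.+1)](wP N.+1) catw_dropw.
move=> i; rewrite size_cat => lei; apply: NP; apply: leq_trans lei.
by rewrite (leq_trans (szv N)) // leq_addl.
Qed.

Lemma connect_steps A (e : rel (state A))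
    (D : state A -> Sigma -> state A -> Prop) :
  (forall q s, e q s -> exists a, D q a s) ->
  forall q s, connect e q s -> exists u, steps D q u s.
Proof.
move=> eD q s /connectP[p]; elim: p q => [|q' p IHp] q /=.
  by move=> _ ->; exists [::].
case/andP=> /eD[a Da] /IHp{}IHp /IHp[u us]; exists (a :: u) => /=.
by exists q'.
Qed.

(** * Nice automata, whose core consists of all safe transitions *)

Section Nice.
Variable A : tNCW Sigma.
Hypothesis niceA : nice A.

(** An accepting run may start with another successor, which is equivalent to [s] by semantic
    determinism. *)
Lemma nice_trans_lang (q s : state A) a w : s \in delta A q a ->
  lang (with_init s) w <-> lang (with_init q) (scons a w).
Proof.
have [_ _ _ _ sd] := niceA => qas; split; first exact: lang_scons.
case=> r [runr accr]; have := lang_dropw 1 runr accr.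
rewrite -[dropw 1 (scons a w)]/w => Lr1.
case: runr => r0 /(_ 0); rewrite r0 => qar1.
exact: (sd _ _ _ _ qar1 qas w).1 Lr1.
Qed.

Lemma nice_coreE (q s : state A) a : core q a s <-> s \in safe_delta q a.
Proof.
split=> [/core_safe //|qas]; have [_ _ nA _ _] := niceA.
have safe_exact x b y : y \in safe_delta x b -> @exact_trans A x b y.
  move=> xby; split=> // w; apply: nice_trans_lang.
  by move: xby; rewrite inE => /andP[].
split; first exact: safe_exact.
apply: (connect_steps (e := @safe_edge _ A)).
  by move=> x y /existsP[b /safe_exact]; exists b.
by apply/nA/connect1/existsP; exists a.
Qed.

Lemma nice_residual (q : state A) : exists u, residual q u.
Proof.
have [reach _ _ _ _] := niceA.
have [|u uq] := connect_steps (D := @trans A) _ (reach q).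
  by move=> x y /existsP[a]; exists a.
exists u => w; rewrite -[lang A _]/(lang (with_init (init A)) _).
elim: u (init A) uq => [|a u IHu] p /=; first by move=> ->.
by case=> p' pap' /IHu ->; apply: nice_trans_lang.
Qed.

Lemma nice_core_deterministic (q s s' : state A) u :
  steps (@core A) q u s -> steps (@core A) q u s' -> s = s'.
Proof.
have [_ _ _ det _] := niceA; elim: u q => [|a u IHu] q /=; first by move=> ->.
case=> p /core_safe qap us [p' /core_safe qap' us'].
have pp' := card_le1_eqP (det q a) _ _ qap qap'.
by apply: IHu us _; rewrite -pp'.
Qed.

Lemma nice_traceable_safe (q s : state A) :
  (forall u, traceable (@core A) q u -> traceable (@core A) s u) ->
  forall w, safe_lang (with_init q) w -> safe_lang (with_init s) w.
Proof.
move=> sub w [r [[r0 rS] rsafe]].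
have [n|r' [r'0 r'P]] := @koenig _ _ (@core A) s w.
  apply: sub; exists (r n); rewrite -[q]r0; apply: steps_run => i.
  by apply/nice_coreE; rewrite inE rS; apply: rsafe.
exists r'; split; first split=> // i.
  by have /core_safe := r'P i; rewrite inE => /andP[].
by move=> i; have /core_safe := r'P i; rewrite inE => /andP[].
Qed.

End Nice.

(** * A counterpart of [subsafe_equiv] across automata, on finite core words *)

Definition core_le A B (q : state A) (s : state B) : Prop :=
  (forall w, lang (with_init q) w <-> lang (with_init s) w) /\
  forall u, traceable (@core A) q u -> traceable (@core B) s u.

Lemma core_le_trans A B C (q : state A) (s : state B) (t : state C) :
  core_le q s -> core_le s t -> core_le q t.
Proof.
move=> [Lqs sqs] [Lst sst]; split=> [w|u /sqs/sst//].
by rewrite Lqs.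
Qed.

(** Induction on the number of states above [q]: a strict step up loses [q] itself. *)
Lemma core_le_maximal A (q : state A) :
  exists2 p : state A, core_le q p &
    forall p' : state A, core_le p p' -> core_le p' p.
Proof.
pose up (p : state A) := [set x : state A | `[< core_le p x >]].
have [n] := ubnP #|up q|; elim: n q => // n IHn q ltqn.
have [maxq|/existsNP[p /not_implyP[qp npq]]] :=
    pselect (forall p' : state A, core_le q p' -> core_le p' q).
  by exists q.
have [|m pm maxm] := IHn p; last by exists m => //; apply: core_le_trans pm.
rewrite -ltnS; apply: leq_trans ltqn; rewrite ltnS; apply: proper_card.
apply/properP; split.
  apply/subsetP => x; rewrite !inE => /asboolP px.
  exact/asboolP/(core_le_trans qp).
by exists q; rewrite inE; apply/asboolP.
Qed.

Lemma strategy_core_le A B (f : seq Sigma -> state B) (q : state A) u :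
  strategy f -> (forall w, lang A w <-> lang B w) -> residual q u ->
  exists v, [/\ core_le q (f (u ++ v)), residual q (u ++ v) &
    forall v', traceable (@core A) q v' -> follows f (u ++ v) v'].
Proof.
move=> fP eqL resq.
have [v loopv fol] := strategy_follows_core fP eqL resq.
have resv : residual q (u ++ v).
  by move=> w; rewrite (steps_core_lang w loopv) resq catw_cat.
exists v; split=> //; split=> [w|v' /fol/follows_steps].
  by rewrite resv eqL (strategy_residual _ fP).
by exists (f ((u ++ v) ++ v')).
Qed.

Lemma nice_core_equiv A B : GFG A -> nice A -> safe_centralized A ->
  GFG B -> (forall w, lang A w <-> lang B w) ->
  forall p : state A, exists s : state B, core_le p s /\ core_le s p.
Proof.
move=> [g gP] niceA cent [f fP] eqL p.
have [q pq maxq] := core_le_maximal p.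
have [_ _ nA _ _] := niceA.
(* Centrality puts [q] in the safe component of [p]. *)
have [v0 qv0p] : exists v, steps (@core A) q v p.
  have : q \in safe_component p.
    apply: cent; split; first exact: pq.1.
    exact: (nice_traceable_safe niceA pq.2).
  rewrite inE => /andP[_]; apply: connect_steps => x y /existsP[a xay].
  by exists a; apply/(nice_coreE niceA).
have [u0 resq] := nice_residual niceA q.
have [v [qf resv fol]] := strategy_core_le fP eqL resq.
set u := u0 ++ v in qf resv fol.
have [|v' [fg _ _]] :=
    @strategy_core_le B A g (f u) u gP (fun w => iff_sym (eqL w)).
  exact: strategy_residual.
(* The state of [g] above [f u] is also above [q], so maximality of [q] closes the chain. *)
have fq : core_le (f u) q.
  exact: core_le_trans fg (maxq _ (core_le_trans qf fg)).
have folv0 : follows f u v0 by apply: fol; exists p.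
have fv0 := follows_steps folv0.
have eqLp w : lang (with_init p) w <-> lang (with_init (f (u ++ v0))) w.
  by rewrite (steps_core_lang w qv0p) (steps_core_lang w fv0); apply: qf.1.
exists (f (u ++ v0)); split; split=> [w|x].
- exact: eqLp.
- case=> s px.
  have /fol/follows_cat[_ /follows_steps fx] :
      traceable (@core A) q (v0 ++ x).
    by exists s; apply/steps_cat; exists p.
  by exists (f ((u ++ v0) ++ x)).
- by rewrite eqLp.
(* By determinism of the core of [A], the path from [q] on [v0 ++ x] passes through [p] after
   [v0]. *)
case=> s fx; have [|t /steps_cat[p' qv0p' p't]] := fq.2 (v0 ++ x).
  by exists s; apply/steps_cat; exists (f (u ++ v0)).
by exists t; rewrite (nice_core_deterministic niceA qv0p qv0p').
Qed.

End Automata.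

Theorem theorem3p6 (Sigma : finType) (A : tNCW Sigma) :
  GFG A -> nice A -> safe_centralized A -> safe_minimal A ->
  forall B : tNCW Sigma,
    GFG B -> (forall w, lang B w <-> lang A w) -> #|state A| <= #|state B|.
Proof.
move=> gfgA niceA cent minA B gfgB eqL.
have [h hP] := choice (nice_core_equiv gfgA niceA cent gfgB
                         (fun w => iff_sym (eqL w))).
(* States with the same image are comparable in both directions through it, hence strongly
   equivalent. *)
apply: (@leq_card _ _ h) => p q hpq; apply: minA.
have [ph hp] := hP p; have [qh hq] := hP q; rewrite -hpq in qh hq.
have [Lpq spq] := core_le_trans ph hq; have [_ sqp] := core_le_trans qh hp.
by split=> // w; split; apply: nice_traceable_safe.
Qed.
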